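(* Let $H$ be a Ramsey-Sidorenko graph. Then $H$ is independence-forcing, and $$h_0(H)\ \leq\ \max\left\{1-a_0(H),\ \frac{e(H)-1}{e(H)}\right\}.$$
   Context: All graphs are finite and simple. $v(H)$ and $e(H)$ denote the numbers of vertices and edges of $H$; $\alpha(G)$ is the independence number and $\overline d(G)$ the average degree of $G$; $\hom(H,G)$ and $\mathrm{inj}(H,G)$ are the numbers of graph homomorphisms and of injective graph homomorphisms from $H$ to $G$. For a graph $H$ with at least one edge and a real number $a>0$, say that $H$ satisfies property $RS(a)$ if there is a constant $C_H>0$ such that for every $n\ge 1$ and every graph $G$ of order $n$, $$\alpha(G)\geq C_H\min\left\{n^{a},\left(\frac{n^{v(H)}}{\hom(H,G)}\right)^{1/e(H)}\right\},$$ where the second term is read as $+\infty$ if $\hom(H,G)=0$. $H$ is Ramsey-Sidorenko if it satisfies $RS(a)$ for some $a>0$. The Ramsey-Sidorenko threshold $a_0(H)$ of a Ramsey-Sidorenko graph $H$ is the supremum of all $a\leq 1$ such that $H$ satisfies $RS(a)$. For a constant $0\le h<1$, say that $H$ satisfies property $IF(h)$ if for graphs $G$ of order $n$ (with $n\to\infty$) and average degree $\overline d(G)\in n^{h+o(1)}$, $$\mathrm{inj}(H,G)\in n^{v(H)-(1-h)e(H)-\Omega(1)}\ \text{ implies }\ \alpha(G)\in n^{1-h+\Omega(1)}.$$ Explicitly: for every sequence of graphs $(G_i)$ with orders $n_i\to\infty$ and $\overline d(G_i)=n_i^{h+o(1)}$, if there is $\varepsilon>0$ with $\mathrm{inj}(H,G_i)\leq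 n_i^{v(H)-(1-h)e(H)-\varepsilon}$ for all sufficiently large $i$, then there is $\varepsilon'>0$ with $\alpha(G_i)\geq n_i^{1-h+\varepsilon'}$ for all sufficiently large $i$. $H$ is independence-forcing if it satisfies $IF(h)$ for some $h$, and its independence-forcing density threshold $h_0(H)$ is the infimum of all such $h$. *)

(* Defs.v *)
From HB Require Import structures.
From mathcomp Require Import all_boot all_order all_algebra.
From mathcomp Require Import all_classical all_reals all_analysis.
Set Implicit Arguments.
Unset Strict Implicit.
Unset Printing Implicit Defensive.
Import Order.TTheory GRing.Theory Num.Theory.
Import numFieldNormedType.Exports.
Local Open Scope classical_set_scope.
Local Open Scope ring_scope.

Record sgraph := SGraph {
  vertex :> finType;
  adj : rel vertex;
  adj_sym : symmetric adj;
  adj_irrefl : irreflexive adj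
}.

Definition edge_set (G : sgraph) : {set {set G}} :=
  [set [set p.1; p.2] | p : G * G & adj p.1 p.2]%SET.

Definition num_vertices (G : sgraph) : nat := #|G|.

Definition num_edges (G : sgraph) : nat := #|edge_set G|.

Definition degree (G : sgraph) (x : G) : nat := #|[set y | adj x y]%SET|.

Definition average_degree (R : realType) (G : sgraph) : R :=
  (\sum_(x : G) degree x)%N%:R / (num_vertices G)%:R.

Definition independent (G : sgraph) (S : {set G}) : bool :=
  [forall x in S, forall y in S, ~~ adj x y].

Definition independence_number (G : sgraph) : nat :=
  (\max_(S : {set G} | independent S) #|S|)%N.

Definition is_hom (H G : sgraph) (f : {ffun H -> G}) : bool :=
  [forall x, forall y, adj x y ==> adj (f x) (f y)].

Definition num_hom (H G : sgraph) : nat :=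
  #|[set f : {ffun H -> G} | is_hom f]%SET|.

Definition num_inj (H G : sgraph) : nat :=
  #|[set f : {ffun H -> G} | is_hom f && injectiveb f]%SET|.

(* (n^v(H) / hom(H, G))^(1 / e(H)), read as +oo when hom(H, G) = 0; it is
   meaningful only when H has at least one edge. *)
Definition sidorenko_term (R : realType) (H G : sgraph) : \bar R :=
  if num_hom H G == 0%N then +oo%E
  else ((((num_vertices G)%:R ^+ num_vertices H / (num_hom H G)%:R)
         `^ (num_edges H)%:R^-1)%:E)%E.

Definition RS (R : realType) (H : sgraph) (a : R) : Prop :=
  exists2 C : R, 0 < C &
    forall G : sgraph, (1 <= num_vertices G)%N ->
      (C%:E * Order.min ((num_vertices G)%:R `^ a)%:E (sidorenko_term R H G)
         <= ((independence_number G)%:R)%:E)%E.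

Definition ramsey_sidorenko (R : realType) (H : sgraph) : Prop :=
  exists2 a : R, 0 < a & RS H a.

(* The set is nonempty when H is Ramsey-Sidorenko (RS is inherited by smaller
   exponents) and bounded by 1, so that [sup] is a genuine supremum. *)
Definition ramsey_sidorenko_threshold (R : realType) (H : sgraph) : R :=
  sup [set a : R | 0 < a <= 1 /\ RS H a].

(* An asymptotic n^(c + o(1)) is an exact power n^(c + delta_i) for some
   delta_i --> 0, required for all sufficiently large i only. *)
Definition IF (R : realType) (H : sgraph) (h : R) : Prop :=
  forall G : nat -> sgraph,
    num_vertices (G i) @[i --> \oo] --> \oo ->
    (exists2 delta : nat -> R, delta i @[i --> \oo] --> (0 : R) &
       \forall i \near \oo,
         average_degree R (G i) = (num_vertices (G i))%:R `^ (h + delta i)) ->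
    (exists2 eps : R, 0 < eps &
       \forall i \near \oo,
         (num_inj H (G i))%:R <=
         (num_vertices (G i))%:R `^
           ((num_vertices H)%:R - (1 - h) * (num_edges H)%:R - eps)) ->
    exists2 eps' : R, 0 < eps' &
      \forall i \near \oo,
        (num_vertices (G i))%:R `^ (1 - h + eps')
          <= (independence_number (G i))%:R :> R.

Definition independence_forcing (R : realType) (H : sgraph) : Prop :=
  exists2 h : R, 0 <= h < 1 & IF H h.

(* The set is bounded below by 0, and nonempty exactly when H is
   independence-forcing; only then is [inf] a genuine infimum. *)
Definition independence_forcing_threshold (R : realType) (H : sgraph) : R :=
  inf [set h : R | 0 <= h < 1 /\ IF H h].

(* Main.v *)
Require Import Defs.
From HB Require Import structures.
From mathcomp Require Import all_boot all_order all_algebra.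
From mathcomp Require Import all_classical all_reals all_analysis.
From mathcomp Require Import lra.
Import Order.TTheory GRing.Theory Num.Theory.
Import numFieldNormedType.Exports.
Local Open Scope classical_set_scope.
Local Open Scope ring_scope.

(** A graph [H] is Ramsey-Sidorenko when few homomorphisms from [H] force a
large independent set, whereas independence forcing starts from few _injective_
homomorphisms.  The two counts differ by at most the number of non-injective
maps from [H] to [G], which is [O(n ^ (v(H) - 1))] ([num_hom_le_num_inj]).  If
[(1 - h) e(H) < 1] this error is smaller, by a power of [n], than
[n ^ (v(H) - (1 - h) e(H))], so the hypothesis of [IF(h)] on [inj(H, G)] carries
over to [hom(H, G)], at the price of a smaller saving [delta] in the exponent
and of a constant factor ([num_hom_le_powR]).  The Sidorenko term is then at
least a constant times [n ^ (1 - h + delta / e(H))].  If moreover [RS(a)] holds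
for some [a > 1 - h], both terms of the minimum exceed [n ^ (1 - h)] by a power
of [n], and half of the surplus absorbs the constants: this is [IF(h)]
([RS_IF]).

The condition [(1 - h) e(H) < 1] is [h > (e(H) - 1) / e(H)], and a suitable [a]
exists as soon as [h > 1 - a_0(H)].  Hence every [h] strictly between the
claimed bound and [1] is in the set whose infimum is [h_0(H)]; such [h] exist
because [a_0(H) > 0]. *)

Lemma leq_card_bigcup {I T : finType} (P : pred I) (A : I -> {set T}) :
  (#|\bigcup_(i | P i) A i| <= \sum_(i | P i) #|A i|)%N.
Proof.
elim/big_rec2: _ => [|i k S _ leSk]; first by rewrite cards0.
by apply: leq_trans (leq_card_setU _ _) _; rewrite leq_add2l.
Qed.

(** A map that identifies [x] and [y], together with an arbitrary new value at
[y], makes up an arbitrary map: the old value at [y] can be read off at [x]. *)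
Lemma card_ffun_collision {A B : finType} (x y : A) : x != y ->
  (#|[set f : {ffun A -> B} | f x == f y]%SET| * #|B| <= #|B| ^ #|A|)%N.
Proof.
move=> neq_xy; rewrite -card_ffun -(cardsT B) -cardsX.
pose upd (fb : {ffun A -> B} * B) :=
  [ffun z => if z == y then fb.2 else fb.1 z].
rewrite -(@card_in_imset _ _ upd) ?max_card // => -[f b] [g c].
rewrite !inE !andbT /= => /eqP fxy /eqP gxy /ffunP eq_upd.
have eq_off z : z != y -> f z = g z.
  by move=> /negPf zy; have := eq_upd z; rewrite !ffunE zy.
have -> : b = c by have := eq_upd y; rewrite !ffunE eqxx.
congr pair; apply/ffunP => z; have [->|] := eqVneq z y; last exact: eq_off.
by rewrite -fxy -gxy eq_off.
Qed.

(** A homomorphism that is not injective identifies one of at most [v(H) ^ 2]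
pairs of vertices, and each pair accounts for at most [n ^ (v(H) - 1)] maps; the
factor [n] on both sides keeps the subtraction out of the exponent. *)
Lemma num_hom_le_num_inj (H G : sgraph) :
  (num_hom H G * num_vertices G <=
   num_inj H G * num_vertices G +
   num_vertices H ^ 2 * num_vertices G ^ num_vertices H)%N.
Proof.
rewrite /num_hom /num_inj /num_vertices.
set coll := fun p : H * H => [set f : {ffun H -> G} | f p.1 == f p.2]%SET.
have sub : [set f : {ffun H -> G} | is_hom f]%SET \subset
    [set f : {ffun H -> G} | is_hom f && injectiveb f]%SET :|:
    \bigcup_(p : H * H | p.1 != p.2) coll p.
  apply/fintype.subsetP => f; rewrite !inE => -> /=.
  have [//|/injectivePn[x [y neq_xy eq_f]]] := boolP (injectiveb f).
  by apply/finset.bigcupP; exists (x, y) => //; rewrite inE eq_f.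
apply: leq_trans (leq_mul (subset_leq_card sub) (leqnn _)) _.
apply: leq_trans (leq_mul (leq_card_setU _ _) (leqnn _)) _.
rewrite mulnDl leq_add2l.
apply: leq_trans (leq_mul (leq_card_bigcup _ _) (leqnn _)) _.
rewrite big_distrl /=.
apply: (@leq_trans (\sum_(p : H * H | p.1 != p.2) #|G| ^ #|H|)).
  by apply: leq_sum => p; exact: card_ffun_collision.
rewrite sum_nat_const leq_mul2r.
by apply/orP; right; rewrite -mulnn -card_prod max_card.
Qed.

Section ExponentBounds.
Context {R : realType}.
Implicit Types (n b c k x : R).

(** A positive constant, however small, costs less than any fixed positive power
of [n] as soon as [n] exceeds an explicit threshold. *)
Lemma powR_absorb {n c k} x : 0 < c -> 0 < k -> c^-1 `^ k^-1 <= n ->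
  n `^ x <= c * n `^ (x + k).
Proof.
move=> c0 k0 le_n.
have cV0 : 0 < c^-1 by rewrite invr_gt0.
have n0 : 0 < n by apply: lt_le_trans le_n; exact: powR_gt0.
have le_c : c^-1 <= n `^ k.
  rewrite -[leLHS](@powRr1 _ _ (ltW cV0)) -(mulVf (lt0r_neq0 k0)) powRrM.
  by apply: ge0_ler_powR le_n; rewrite ?nnegrE ?powR_ge0 // ltW.
rewrite powRD ?(gt_eqF n0) ?implybT // mulrCA ler_peMr ?powR_ge0 //.
by rewrite -ler_pdivrMl // mulr1.
Qed.

(** Two sources limit the saving [delta]: the saving [eps] granted to injective
homomorphisms, and the gap [1 - b] between the reference exponent [v(H) - b]
and the exponent [v(H) - 1] that counts non-injective maps. *)
Lemma num_hom_le_powR {H G : sgraph} {b eps delta : R} :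
  (1 <= num_vertices G)%N -> delta <= eps -> delta <= 1 - b ->
  (num_inj H G)%:R <=
    (num_vertices G)%:R `^ ((num_vertices H)%:R - b - eps) ->
  (num_hom H G)%:R <= ((num_vertices H ^ 2).+1)%:R *
    (num_vertices G)%:R `^ ((num_vertices H)%:R - b - delta).
Proof.
set n : R := (num_vertices G)%:R; set v : R := (num_vertices H)%:R.
move=> n1 le_eps le_gap le_inj.
have n1R : 1 <= n by rewrite ler1n.
have n0 : 0 < n by apply: lt_le_trans n1R.
have nnz : n != 0 by rewrite gt_eqF.
have := num_hom_le_num_inj H G; rewrite -(ler_nat R) natrD !natrM => le_hom.
rewrite -(ler_pM2r n0); apply: le_trans le_hom _.
rewrite -[(_.+1)%:R]natr1 addrC mulrDl mul1r mulrDl [leRHS]addrC addrC lerD //.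
  rewrite ler_pM2r //; apply: le_trans le_inj _.
  by apply: ler_powR => //; rewrite lerB.
rewrite -natrM mulnn -mulrA ler_wpM2l ?ler0n //.
rewrite natrX -powR_mulrn ?ler0n // -/n -/v.
rewrite -{3}(powRr1 (ltW n0)) -powRD ?nnz ?implybT //.
by apply: ler_powR => //; lra.
Qed.

(** With [s = (1 - h) e(H) + delta] the exponent obtained is
[1 - h + delta / e(H)]: any saving [delta] in the homomorphism count pushes the
Sidorenko term polynomially above the target [n ^ (1 - h)]. *)
Lemma sidorenko_term_ge {H G : sgraph} {K s : R} :
  (1 <= num_vertices G)%N -> 0 < K ->
  (num_hom H G)%:R <=
    K * (num_vertices G)%:R `^ ((num_vertices H)%:R - s) ->
  (((K^-1 `^ (num_edges H)%:R^-1) *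
     (num_vertices G)%:R `^ (s / (num_edges H)%:R))%:E
   <= sidorenko_term R H G)%E.
Proof.
set n : R := (num_vertices G)%:R => n1 K0 le_hom.
have n0 : 0 < n by rewrite ltr0n.
rewrite /sidorenko_term; case: eqP => [_|/eqP hom_neq0]; first exact: leey.
have hom0 : 0 < (num_hom H G)%:R :> R by rewrite ltr0n lt0n.
rewrite lee_fin powRrM -powRM ?powR_ge0 ?invr_ge0 ?(ltW K0) //.
apply: ge0_ler_powR; rewrite ?nnegrE ?invr_ge0 ?ler0n //.
  by rewrite mulr_ge0 ?powR_ge0 ?invr_ge0 ?(ltW K0).
rewrite ler_pdivlMr // -mulrA ler_pdivrMl //.
apply: le_trans (ler_wpM2l (powR_ge0 _ _) le_hom) _.
rewrite mulrCA ler_wpM2l ?(ltW K0) // -powRD ?(gt_eqF n0) ?implybT //.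
by rewrite addrC subrK powR_mulrn // ltW.
Qed.

(** Makes the set whose supremum is [a_0(H)] nonempty, as an [a > 1] satisfying
[RS] may be lowered to [1]. *)
Lemma RS_anti {H : sgraph} {a b : R} : b <= a -> RS H a -> RS H b.
Proof.
move=> le_ba [C C0 RSa]; exists C => // G n1; apply: le_trans (RSa G n1).
apply: lee_wpmul2l; first by rewrite lee_fin ltW.
by apply: le_min2 => //; rewrite lee_fin ler_powR ?ler1n.
Qed.

(** Since [RS(a)] holds with one constant for all graphs, the inequality is
proved for each large graph of the sequence separately, with the same surplus
[gamma]: it is the smaller of the surpluses over [1 - h] of the exponents of
the two terms of the minimum. *)
Lemma RS_IF {H : sgraph} {a h : R} : (1 <= num_edges H)%N ->
  RS H a -> 1 - h < a -> (1 - h) * (num_edges H)%:R < 1 -> IF H h.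
Proof.
move=> e1 [C C0 RSa] lt_a lt_b G /cvgnyPge G_oo _ [eps eps0 inj_le].
have e0 : 0 < (num_edges H)%:R :> R by rewrite ltr0n.
set e : R := (num_edges H)%:R in lt_b inj_le e0 *.
set b := (1 - h) * e in lt_b inj_le *.
pose delta := Num.min eps (1 - b).
have delta0 : 0 < delta by rewrite lt_min eps0 subr_gt0.
pose gamma := Num.min (a - (1 - h)) (delta / e).
have gamma0 : 0 < gamma by rewrite lt_min subr_gt0 lt_a divr_gt0.
pose K : R := ((num_vertices H ^ 2).+1)%:R.
have K0 : 0 < K by rewrite ltr0n.
have K1 : 1 <= K by rewrite ler1n.
pose D := K^-1 `^ e^-1.
have D0 : 0 < D by rewrite powR_gt0 // invr_gt0.
have D1 : D <= 1.
  have <- : 1 `^ e^-1 = 1 :> R by rewrite powR1.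
  by apply: ge0_ler_powR; rewrite ?nnegrE ?invr_ge0 ?ler0n // invf_le1.
have CD0 : 0 < C * D by rewrite mulr_gt0.
have gamma2_gt0 : 0 < gamma / 2 by rewrite divr_gt0.
exists (gamma / 2) => //.
near=> i.
set n : R := (num_vertices (G i))%:R.
have n1 : (1 <= num_vertices (G i))%N by near: i; exact: G_oo.
have n1R : 1 <= n by rewrite ler1n.
have n_large : (C * D)^-1 `^ (gamma / 2)^-1 <= n.
  apply: le_trans (ltW (truncnS_gt _)) _; rewrite ler_nat.
  by near: i; exact: G_oo.
(* Half of the surplus [gamma] pays for the constant [C * D]. *)
apply: le_trans (powR_absorb _ CD0 gamma2_gt0 n_large) _.
rewrite -addrA -splitr -lee_fin; apply: le_trans (RSa (G i) n1).
rewrite -mulrA EFinM; apply: lee_wpmul2l; first by rewrite lee_fin ltW.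
rewrite le_min; apply/andP; split.
  rewrite lee_fin -[leRHS]mul1r ler_pM ?powR_ge0 ?(ltW D0) //.
  apply: ler_powR => //; rewrite addrC -lerBrDr.
  by rewrite ge_min lexx.
have hom_le : (num_hom H (G i))%:R <=
    K * n `^ ((num_vertices H)%:R - (b + delta)).
  rewrite opprD addrA; apply: (@num_hom_le_powR _ _ _ eps) => //.
  - by rewrite ge_min lexx.
  - by rewrite ge_min lexx orbT.
  - by near: i.
apply: le_trans (sidorenko_term_ge n1 K0 hom_le).
rewrite lee_fin ler_wpM2l ?(ltW D0) //; apply: ler_powR => //.
rewrite mulrDl mulfK ?gt_eqF // lerD2l.
by rewrite ge_min lexx orbT.
Unshelve. all: by end_near. Qed.

End ExponentBounds.

Theorem proposition11 (R : realType) (H : sgraph)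
    (edgeH : (1 <= num_edges H)%N) (RSH : ramsey_sidorenko R H) :
  independence_forcing R H /\
  independence_forcing_threshold R H <=
    Num.max (1 - ramsey_sidorenko_threshold R H)
            (((num_edges H)%:R - 1) / (num_edges H)%:R).
Proof.
set e : R := (num_edges H)%:R; set a0 := ramsey_sidorenko_threshold R H.
set m := Num.max _ _.
have e0 : 0 < e by rewrite ltr0n.
pose S := [set a : R | 0 < a <= 1 /\ RS H a].
have S_ub : has_ubound S by exists 1 => a [/andP[]].
have [a Sa] : S !=set0.
  have [a a_gt0 RSa] := RSH; exists (Num.min a 1); split.
    by rewrite lt_min a_gt0 ltr01 ge_min lexx orbT.
  by apply: RS_anti RSa; rewrite ge_min lexx.
have a0_gt0 : 0 < a0.
  by apply: lt_le_trans (ub_le_sup S_ub Sa); case: Sa => /andP[].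
have m_ge0 : 0 <= m.
  rewrite le_max; apply/orP; right.
  by rewrite divr_ge0 ?ler0n // subr_ge0 ler1n.
have m_lt1 : m < 1.
  rewrite gt_max ltrBlDr ltrDl a0_gt0 /=.
  by rewrite ltr_pdivrMr // mul1r ltrBlDr ltrDl.
have IF_above h : m < h -> IF H h.
  rewrite gt_max => /andP[lt_h1 lt_h2].
  have lt_1h : 1 - h < a0 by lra.
  have [a' [_ RSa'] lt_a'] := @sup_gt _ S _ (ex_intro _ a Sa) lt_1h.
  apply: (RS_IF edgeH RSa' lt_a').
  by move: lt_h2; rewrite ltr_pdivrMr // mulrBl mul1r; lra.
have threshold_le h : m < h -> h < 1 -> independence_forcing_threshold R H <= h.
  move=> lt_mh lt_h1; apply: ge_inf; first by exists 0 => x [/andP[]].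
  by split; [rewrite lt_h1 (le_trans m_ge0 (ltW lt_mh))|exact: IF_above].
split.
  exists ((m + 1) / 2); last by apply: IF_above; rewrite midf_lt.
  by apply/andP; split; lra.
rewrite leNgt; apply/negP => lt_m_inf.
(* The infimum may a priori exceed 1, where [IF] is not considered, hence the cap
   before taking a midpoint. *)
pose h := (m + Num.min (independence_forcing_threshold R H) 1) / 2.
have lt_m_min : m < Num.min (independence_forcing_threshold R H) 1.
  by rewrite lt_min lt_m_inf.
have [lt_mh lt_h] := midf_lt lt_m_min.
move: lt_h; rewrite lt_min => /andP[lt_h_inf lt_h1].
by have := threshold_le h lt_mh lt_h1; rewrite leNgt lt_h_inf.
Qed.
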